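(* For every negative integer $-t$ (that is, for every positive integer $t$), every positive integer $a$, and every $\epsilon>0$, there exists a positive integer $N$ such that if $n>N$, then the polynomial $D_{n,a}(x)$ has a root $x_t$ satisfying $|-t-x_t|<\epsilon$.
   Context: A permutation is called an $a$-derangement if each of its cycles is longer than $a$ (has length at least $a+1$). $d_a(n,k)$ denotes the number of $a$-derangements of length $n$ (i.e. of $\{1,\dots,n\}$) with exactly $k$ cycles, and $D_{n,a}(x)=\sum_{k=1}^{\lfloor n/(a+1)\rfloor} d_a(n,k)x^k$. The paper recalls as previously known (Brenti) that all roots of $D_{n,a}(x)$ are real and non-positive. *)

(* Defs.v *)
From HB Require Import structures.
From mathcomp Require Import all_boot all_order all_fingroup all_algebra.

Set Implicit Arguments.
Unset Strict Implicit.
Unset Printing Implicit Defensive.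

Import GRing.Theory.
Local Open Scope ring_scope.

(* [porbits s] is the set of supports of the cycles of [s]; fixed points count
   as cycles of length 1. *)
Definition a_derangement (a n : nat) (s : 'S_n) : bool :=
  [forall c in porbits s, (a < #|c|)%N].

Definition derangement_count (a n k : nat) : nat :=
  #|[set s : 'S_n | a_derangement a s & #|porbits s| == k]|.

Definition derangement_poly (R : nzRingType) (n a : nat) : {poly R} :=
  \sum_(1 <= k < (n %/ a.+1).+1) (derangement_count a n k)%:R *: 'X^k.

(* Main.v *)
(* With [y l = x] for [l > a] and [y l = 0] otherwise, D_{n,a}(x) / n! is the
   coefficient of z^n in exp (\sum_l y_l z^l / l).  At x = - s this series is
   (1 - z)^s * exp (s (z + ... + z^a / a)).  For t < s < t + 1, the coefficients
   of the first factor have the constant sign (-1)^(t+1) from index t + 1 on and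
   are at least of order 2^-n, while those of the second factor are nonnegative
   and O(4^-n).  In the convolution, all terms but the t + 1 initial ones share
   the sign (-1)^(t+1), and these initial ones are O(4^-n), so D_{n,a}(- s) has
   the sign (-1)^(t+1) for all large n.  Hence D_{n,a} changes sign across every
   negative integer, and the intermediate value theorem gives the root. *)
Require Import Defs.
From mathcomp Require Import all_boot all_order all_fingroup all_algebra.
From mathcomp Require Import reals.
From mathcomp Require Import ring lra zify.

Set Implicit Arguments.
Unset Strict Implicit.
Unset Printing Implicit Defensive.

Import Order.TTheory GRing.Theory Num.Theory.
Local Open Scope ring_scope.

(** * Sums over permutations weighted by cycle lengths *)

Section CycleWeights.
Variables (R : comNzRingType) (y : nat -> R).

(* Sum over the permutations of n points of the product of [y (length)] over the
   cycles, the cycle of one marked point being counted as [j] longer than it is: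
   the recursion deletes the marked point and marks its successor. *)
Fixpoint cycle_sum (n j : nat) : R :=
  if n is m.+1 then y j.+1 * cycle_sum m 0 + m%:R * cycle_sum m j.+1 else 1.

Variable T : finType.
Implicit Types (s : {perm T}) (A B C : {set T}) (x z : T).

(** Restricting to cycles inside [B] lets [B = A :\ x] drop the cycle of [x], and lets [B = A]
    discard the fixed points outside [A]. *)
Definition cycle_weight s B : R := \prod_(C in porbits s | C \subset B) y #|C|.

Lemma mem_porbits s C x : C \in porbits s -> x \in C -> C = porbit s x.
Proof.
by case/imsetP=> z _ -> xz; apply/eqP; rewrite eq_porbit_mem porbit_sym.
Qed.

Lemma porbit_sub s C x :
  x \in C -> {in C, forall z, s z \in C} -> porbit s x \subset C.
Proof.
move=> xC sC; apply/subsetP=> _ /porbitP[i ->].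
by elim: i => [|i IHi]; rewrite ?perm1 // expgSr permM sC.
Qed.

Lemma porbit_closed s x z : z \in porbit s x -> s z \in porbit s x.
Proof. by move=> /porbitP[i ->]; rewrite -permM -expgSr mem_porbit. Qed.

Lemma eq_in_porbit s s' x :
  {in porbit s x, s =1 s'} -> porbit s' x = porbit s x.
Proof.
move=> ss'; apply/setP=> z; apply/porbitP/porbitP => -[i ->]; exists i.
  elim: i => [|i IHi]; rewrite ?perm1 // !expgSr !permM IHi ss' //.
  exact: mem_porbit.
elim: i => [|i IHi]; rewrite ?perm1 // !expgSr !permM -IHi ss' //.
exact: mem_porbit.
Qed.

Lemma mem_porbits_eq_in s s' C :
  {in C, s =1 s'} -> (C \in porbits s) = (C \in porbits s').
Proof.
move=> ss'; apply/imsetP/imsetP => -[x _ defC]; exists x => //.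
  by rewrite (@eq_in_porbit s) -?defC.
by rewrite (@eq_in_porbit s') -?defC // => z /ss'.
Qed.

Section InsertPoint.
Variables (s : {perm T}) (x0 x1 : T).
Hypotheses (sx0 : s x0 = x0) (neq_x01 : x1 != x0).
(** Products act left to right: [s1] sends [x1] to [x0] and [x0] to [s x1], so [x0] is spliced into
    the cycle of [x1]. *)
Let s1 : {perm T} := (tperm x0 x1 * s)%g.

Let s1x0 : s1 x0 = s x1. Proof. by rewrite permM tpermL. Qed.
Let s1x1 : s1 x1 = x0. Proof. by rewrite permM tpermR. Qed.
Let s1D z : z != x0 -> z != x1 -> s1 z = s z.
Proof. by move=> z0 z1; rewrite permM tpermD // eq_sym. Qed.

Lemma notin_porbit_fixed : x0 \notin porbit s x1.
Proof.
rewrite porbit_sym; apply: contra neq_x01 => /porbitP[i ->].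
by elim: i => [|i /eqP IHi]; rewrite ?perm1 // expgSr permM IHi sx0.
Qed.

Lemma porbit_insert : porbit s1 x0 = x0 |: porbit s x1.
Proof.
have x1s1 : x1 \in porbit s1 x0.
  by rewrite porbit_sym -s1x1 -{1}(expg1 s1) mem_porbit.
apply/eqP; rewrite eqEsubset; apply/andP; split.
  apply: porbit_sub => [|z]; first by rewrite !inE eqxx.
  have [-> _|z0] := eqVneq z x0.
    by rewrite s1x0 !inE porbit_closed ?orbT // porbit_id.
  have [-> _|z1] := eqVneq z x1; first by rewrite s1x1 !inE eqxx.
  by rewrite s1D // !inE (negPf z0) /= => /porbit_closed ->; rewrite orbT.
rewrite subUset sub1set porbit_id /=.
suff: porbit s x1 \subset porbit s1 x0 :\ x0 by rewrite subsetD1 => /andP[].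
apply: porbit_sub => [|z]; first by rewrite !inE neq_x01.
rewrite !inE => /andP[z0 zs1]; rewrite -{1}sx0 (inj_eq perm_inj) z0 /=.
have [->|z1] := eqVneq z x1; first by rewrite -s1x0 porbit_closed ?porbit_id.
by rewrite -s1D // porbit_closed.
Qed.

Lemma card_porbit_insert : #|porbit s1 x0| = #|porbit s x1|.+1.
Proof. by rewrite porbit_insert cardsU1 notin_porbit_fixed. Qed.

(** A cycle of [s1] avoiding [x0] also avoids [x1], and away from these two points [s1] and [s]
    agree. *)
Lemma cycle_weight_insert A :
  cycle_weight s1 (A :\ x0) = cycle_weight s (A :\ x0 :\ x1).
Proof.
have x1s1 : x1 \in porbit s1 x0 by rewrite porbit_insert !inE porbit_id orbT.
apply: eq_bigl => C; rewrite !subsetD1.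
have [x1C|x1C] /= := boolP (x1 \in C).
  rewrite !andbF; apply/negP => /and3P[Cs1 _ /negP[]].
  by rewrite (mem_porbits Cs1 x1C) porbit_sym.
rewrite andbT; have [x0C|x0C] /= := boolP (x0 \in C); first by rewrite !andbF.
congr (_ && _); apply: mem_porbits_eq_in => z zC.
by apply: s1D; [apply: contraNneq x0C => <-|apply: contraNneq x1C => <-].
Qed.

End InsertPoint.

Lemma cycle_weight_split s A x : x \in A -> perm_on A s ->
  cycle_weight s A = y #|porbit s x| * cycle_weight s (A :\ x).
Proof.
move=> xA sA; rewrite /cycle_weight (bigD1 (porbit s x)) /=; last first.
  by rewrite imset_f //= porbit_sub // => z; rewrite perm_closed.
congr (_ * _); apply: eq_bigl => C; rewrite subsetD1 -andbA.
have [Cs|//] /= := boolP (C \in porbits s); congr (_ && _).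
apply/idP/idP => [|xC]; first by apply: contra => /(mem_porbits Cs) ->.
by apply: contraNneq xC => ->; rewrite porbit_id.
Qed.

Lemma perm_onD1 A s x : perm_on (A :\ x) s = perm_on A s && (s x == x).
Proof.
apply/subsetP/andP => [sAx|[/subsetP sA /eqP sx] z].
  split; first by apply/subsetP => z /sAx /setD1P[].
  by apply/negP => /negP /(sAx x); rewrite !inE eqxx.
by move=> sz; rewrite !inE sA // andbT; apply: contraNneq sz => ->; rewrite sx.
Qed.

Lemma perm_on_tperm_mul A s x z : x \in A -> z \in A ->
  perm_on A (tperm x z * s)%g = perm_on A s.
Proof.
move=> xA zA; have tA : perm_on A (tperm x z).
  apply/subsetP => w; apply: contraR => wA; rewrite tpermD //.
    by apply: contraNneq wA => <-.
  by apply: contraNneq wA => <-.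
apply/idP/idP => sA; last exact: perm_onM.
by rewrite -(mulKg (tperm x z) s) tpermV; apply: perm_onM.
Qed.

(** Both claims are needed in one induction: deleting a fixed marked point leaves an unmarked sum,
    deleting any other marked point leaves a marked sum. *)
Lemma cycle_sumP A :
  \sum_(s : {perm T} | perm_on A s) cycle_weight s A = cycle_sum #|A| 0 /\
  forall j x, x \in A ->
    \sum_(s : {perm T} | perm_on A s)
        y (#|porbit s x| + j) * cycle_weight s (A :\ x) = cycle_sum #|A| j.
Proof.
have [n] := ubnP #|A|; elim: n A => // n IHn A leAn.
have marked j x : x \in A ->
    \sum_(s : {perm T} | perm_on A s)
      y (#|porbit s x| + j) * cycle_weight s (A :\ x) = cycle_sum #|A| j.
  move=> xA; have cardA : #|A| = #|A :\ x|.+1 by rewrite (cardsD1 x) xA.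
  have [IH0 IHj] := IHn (A :\ x) ltac:(by rewrite -ltnS -cardA).
  (* Classify [s] by the predecessor [z] of [x]; left multiplication by [tperm x z] turns these [s]
     into the permutations of [A] that fix [x]. *)
  rewrite (partition_big (fun s : {perm T} => (s^-1)%g x) (mem A)) /=;
    last by move=> s sA; rewrite (perm_closed _ (perm_onV sA)).
  have reidx z : z \in A ->
      \sum_(s : {perm T} | perm_on A s && ((s^-1)%g x == z))
        y (#|porbit s x| + j) * cycle_weight s (A :\ x) =
      \sum_(s : {perm T} | perm_on (A :\ x) s)
        y (#|porbit (tperm x z * s)%g x| + j)
          * cycle_weight (tperm x z * s)%g (A :\ x).
    move=> zA; rewrite (reindex_inj (mulgI (tperm x z))) /=.
    apply: eq_bigl => s; rewrite perm_on_tperm_mul // perm_onD1; congr (_ && _).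
    rewrite invMg tpermV permM -{2}(tpermL x z) (inj_eq perm_inj).
    by rewrite -(inj_eq (@perm_inj _ s)) permKV eq_sym.
  rewrite (bigD1 x) //= reidx // cardA /=; congr (_ + _).
    rewrite -IH0 mulr_sumr; apply: eq_bigr => s.
    rewrite perm_onD1 tperm1 mul1g => /andP[_ /eqP sx].
    suff -> : porbit s x = [set x] by rewrite cards1 add1n.
    apply/eqP; rewrite eqEsubset sub1set porbit_id andbT.
    by apply: porbit_sub => [|z]; rewrite !inE // => /eqP->; rewrite sx.
  (* Each [z] other than [x] gives the same sum: [z] becomes the marked point, its cycle one shorter
     and [j] one larger. *)
  rewrite [LHS](eq_bigr (fun=> cycle_sum #|A :\ x| j.+1)) => [|z /andP[zA zx]].
    rewrite sumr_const mulr_natl; congr (_ *+ _).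
    by apply: eq_card => z; rewrite !inE andbC.
  rewrite reidx // -(IHj _ z) ?inE ?zx //; apply: eq_bigr => s.
  rewrite perm_onD1 => /andP[_ /eqP sx].
  by rewrite card_porbit_insert // cycle_weight_insert // addSnnS.
split=> //; have [A0|[x xA]] := set_0Vmem A.
  rewrite A0 cards0 (big_pred1 1%g) => [|s]; last first.
    apply/idP/eqP => [s0|->]; last exact: perm_on1.
    by apply: (perm_on_id s0); rewrite cards0.
  rewrite /cycle_weight big_pred0 // => C; rewrite subset0.
  apply/negP => /andP[/imsetP[x _ ->]] /eqP/setP/(_ x).
  by rewrite porbit_id inE.
rewrite -(marked 0 x xA); apply: eq_bigr => s sA.
by rewrite addn0 -cycle_weight_split.
Qed.

Lemma sum_perm_cycles :
  \sum_(s : {perm T}) \prod_(C in porbits s) y #|C| = cycle_sum #|T| 0.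
Proof.
rewrite -cardsT -(cycle_sumP setT).1.
apply: eq_big => [s|s _]; first by apply/esym/subsetP => x; rewrite inE.
by apply: eq_bigl => C; rewrite subsetT andbT.
Qed.

End CycleWeights.

(** * Derangement polynomials as weighted cycle sums *)

Definition derangement_weight (R : nzRingType) (a : nat) (x : R) (l : nat) : R :=
  if (a < l)%N then x else 0.

Lemma porbits_partition (T : finType) (s : {perm T}) :
  partition (porbits s) [set: T].
Proof.
apply/and3P; split.
- rewrite eqEsubset subsetT /=; apply/subsetP => x _.
  by apply/bigcupP; exists (porbit s x); rewrite ?imset_f ?porbit_id.
- apply/trivIsetP => B C Bs Cs; apply: contraNT => /pred0Pn[x /andP[/= xB xC]].
  by rewrite (mem_porbits Bs xB) (mem_porbits Cs xC).
- by apply/negP => /imsetP[x _ /setP/(_ x)]; rewrite porbit_id inE.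
Qed.

(** This ensures that the upper limit [n %/ a.+1] in [derangement_poly] leaves out no
    a-derangement. *)
Lemma a_derangement_card_porbits (a n : nat) (s : 'S_n) :
  a_derangement a s -> (#|porbits s| * a.+1 <= n)%N.
Proof.
move=> /forall_inP lt_a; rewrite -[leqRHS]card_ord -cardsT.
rewrite (card_partition (porbits_partition s)) -sum_nat_const.
exact: leq_sum.
Qed.

Lemma prod_derangement_weight (R : comNzRingType) (a n : nat) (x : R) (s : 'S_n) :
  \prod_(C in porbits s) derangement_weight a x #|C| =
  if a_derangement a s then x ^+ #|porbits s| else 0.
Proof.
have [/forall_inP lt_a|] := ifPn.
  rewrite -prodr_const; apply: eq_bigr => C /lt_a.
  by rewrite /derangement_weight => ->.
case/forall_inPn => C Cs /negPf leCa.
by rewrite (bigD1 C) //= /derangement_weight leCa mul0r.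
Qed.

(** After exchanging the sums, each a-derangement meets exactly one exponent [k]. At [n = 0] the
    polynomial is 0 but the cycle sum is 1. *)
Lemma horner_derangement_poly (R : comNzRingType) (n a : nat) (x : R) :
  (0 < n)%N ->
  (derangement_poly R n a).[x] = cycle_sum (derangement_weight a x) n 0.
Proof.
move=> n0; rewrite -{2}(card_ord n) -sum_perm_cycles horner_sum.
under [LHS]eq_bigr => k _.
  rewrite hornerZ hornerXn mulr_natl -sumr_const.
  rewrite (eq_bigl (fun s => a_derangement a s && (k == #|porbits s|)));
    last by move=> s; rewrite inE eq_sym.
  rewrite big_mkcondr.
  over.
rewrite exchange_big big_mkcond /=; apply: eq_bigr => s _.
rewrite prod_derangement_weight; case: ifP => // sa.
rewrite -big_mkcond big_nat1_eq ltnS leq_divRL //.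
rewrite a_derangement_card_porbits // andbT card_gt0 ifT //.
by apply/set0Pn; exists (porbit s (Ordinal n0)); rewrite imset_f.
Qed.

(** * Exponential generating functions of cycle sums *)

Section CycleCoefficients.
Variable R : numFieldType.
Implicit Types y z : nat -> R.

Definition cycle_coef y n : R := cycle_sum y n 0 / n`!%:R.

Lemma cycle_coef0 y : cycle_coef y 0 = 1.
Proof. by rewrite /cycle_coef /= divr1. Qed.

(** The index [k] counts the points off the marked cycle, whose other [n - k] points can be chosen
    and ordered in n! / k! ways. *)
Lemma cycle_sumS y n j :
  cycle_sum y n.+1 j =
  n`!%:R * \sum_(k < n.+1) y (n - k + j).+1 * cycle_coef y k.
Proof.
elim: n j => [|n IHn] j.
  by rewrite big_ord1 cycle_coef0 /= mulr1 mul0r addr0 mul1r.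
rewrite big_ord_recr subnn add0n mulrDr [LHS]/= -/(cycle_sum y n.+1 _).
rewrite addrC; congr (_ + _); last first.
  rewrite /cycle_coef mulrCA [X in _ = _ * X]mulrC mulfVK //.
  by rewrite pnatr_eq0 -lt0n fact_gt0.
rewrite -[X in _ * X]/(cycle_sum y n.+1 j.+1) IHn mulrA -natrM -factS.
congr (_ * _); apply: eq_bigr => k _; congr (y _ * _).
by move: (ltn_ord k) => /=; lia.
Qed.

(** Coefficientwise, this is z F' = (sum_l y_l z^l) F for the generating function F. *)
Lemma cycle_coef_rec y n :
  n%:R * cycle_coef y n = \sum_(k < n) y (n - k)%N * cycle_coef y k.
Proof.
case: n => [|n]; first by rewrite mul0r big_ord0.
have n0 : n.+1%:R != 0 :> R by rewrite pnatr_eq0.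
have f0 : n`!%:R != 0 :> R by rewrite pnatr_eq0 -lt0n fact_gt0.
rewrite {1}/cycle_coef cycle_sumS factS natrM.
rewrite (eq_bigr (fun k : 'I_n.+1 => y (n.+1 - k)%N * cycle_coef y k)) => [|k _].
  by set S := \sum_(k < _) _; field; rewrite f0 nat1r.
by rewrite addn0 subSn ?leq_ord.
Qed.

Lemma cycle_coef_uniq y (h : nat -> R) : h 0%N = 1 ->
  (forall n, n%:R * h n = \sum_(k < n) y (n - k)%N * h k) ->
  h =1 cycle_coef y.
Proof.
move=> h0 hrec n; elim/ltn_ind: n => -[|n] IHn; first by rewrite cycle_coef0.
have n0 : n.+1%:R != 0 :> R by rewrite pnatr_eq0.
apply: (mulfI n0); rewrite hrec cycle_coef_rec.
by apply: eq_bigr => k _; rewrite IHn.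
Qed.

(** This replaces multiplication of power series modulo ['X^m.+1]. *)
Lemma eq_coefM (p p' q q' : {poly R}) m :
    (forall i, (i <= m)%N -> p`_i = p'`_i) ->
    (forall i, (i <= m)%N -> q`_i = q'`_i) ->
  forall i, (i <= m)%N -> (p * q)`_i = (p' * q')`_i.
Proof.
move=> pp' qq' i le_im; rewrite !coefM; apply: eq_bigr => -[k le_ki] _ /=.
by rewrite pp' ?qq' //; lia.
Qed.

(* The generating function of [cycle_coef y] is [exp (\sum_l y l 'X^l / l)],
   characterised by its logarithmic derivative; the latter is additive. *)
Lemma cycle_coefD y z n :
  cycle_coef (fun l => y l + z l) n =
  \sum_(k < n.+1) cycle_coef y k * cycle_coef z (n - k).
Proof.
apply/esym; move: n; apply: cycle_coef_uniq => [|n].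
  by rewrite big_ord1 !cycle_coef0 mul1r.
(* [w] clears the coefficient at 0, since the sum over [l] starts at 1; [P] truncates at degree
   [n]. *)
pose w u l : R := if l is 0%N then 0 else u l : R.
pose P (u : nat -> R) := \poly_(i < n.+1) u i.
have cP u i : (i <= n)%N -> (P u)`_i = u i by rewrite coef_poly ltnS => ->.
have logder u i : (i <= n)%N ->
    ('X * (P (cycle_coef u))^`())`_i = (P (w u) * P (cycle_coef u))`_i.
  move=> le_in; rewrite coefXM coef_deriv coefMr.
  rewrite big_ord_recr /= subnn [(P (w u))`_0]cP // mul0r addr0.
  case: i le_in => [|i] le_in; first by rewrite big_ord0.
  rewrite /= cP // -mulr_natl cycle_coef_rec; apply: eq_bigr => -[k lt_ki] _ /=.
  by rewrite !cP ?subSn //; lia.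
pose S m := \sum_(k < m.+1) cycle_coef y k * cycle_coef z (m - k).
rewrite -/(S n); transitivity (\sum_(k < n) (y (n - k)%N + z (n - k)%N) * S k) => //.
have cS m : (m <= n)%N -> (P (cycle_coef y) * P (cycle_coef z))`_m = S m.
  move=> le_mn; rewrite coefM; apply: eq_bigr => -[k lt_km] _ /=.
  by rewrite !cP //; lia.
have der : ('X * (P (cycle_coef y) * P (cycle_coef z))^`())`_n = n%:R * S n.
  rewrite coefXM coef_deriv; case: (n) cS => [|m] cS; first by rewrite mul0r.
  by rewrite /= cS // mulr_natl.
rewrite -der derivM mulrDr mulrA [X in _ + X]mulrCA coefD.
rewrite (@eq_coefM _ (P (w y) * P (cycle_coef y)) _ (P (cycle_coef z)) n) //;
  last exact: logder.
rewrite (@eq_coefM (P (cycle_coef y)) (P (cycle_coef y))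
  ('X * (P (cycle_coef z))^`()) (P (w z) * P (cycle_coef z)) n) //;
  last exact: logder.
rewrite [P (cycle_coef y) * (_ * _)]mulrCA -mulrA -coefD -mulrDl coefMr big_ord_recr /= subnn.
rewrite coefD !cP // addr0 mul0r addr0; apply: eq_bigr => -[k lt_kn] _ /=.
rewrite cS ?coefD; last exact: ltnW.
rewrite !cP; try lia.
by case: (n - k)%N (subn_gt0 k n) => [|l]; rewrite ?lt_kn.
Qed.

Lemma cycle_coef_ge0 y n : (forall l, 0 <= y l) -> 0 <= cycle_coef y n.
Proof.
move=> y0; apply: divr_ge0 => //; elim: n 0%N => [|n IHn] j //=.
by rewrite addr_ge0 // mulr_ge0.
Qed.

(** This is the recursion for the coefficients of (1 - z)^(-v). *)
Lemma cycle_coef_const (v : R) n :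
  n.+1%:R * cycle_coef (fun=> v) n.+1 = (n%:R + v) * cycle_coef (fun=> v) n.
Proof. by rewrite cycle_coef_rec big_ord_recr /= -cycle_coef_rec mulrDl. Qed.

End CycleCoefficients.

Lemma eq_cycle_coef (R : numFieldType) (y z : nat -> R) :
  y =1 z -> cycle_coef y =1 cycle_coef z.
Proof.
move=> eq_yz; apply: cycle_coef_uniq => [|n]; first exact: cycle_coef0.
by rewrite cycle_coef_rec; apply: eq_bigr => k _; rewrite eq_yz.
Qed.

(** * Growth and signs of the coefficients *)

Section Asymptotics.
Variable R : archiRealFieldType.

Definition short_weight (a : nat) (s : R) (l : nat) : R :=
  if (a < l)%N then 0 else s.

Lemma short_weight_ge0 a s l : 0 <= s -> 0 <= short_weight a s l.
Proof. by rewrite /short_weight; case: ifP. Qed.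

(** At most [a] terms of the recursion are nonzero, and after scaling each is at most [s * 4 ^+ a]
    times the bound on earlier values. Division by [n] preserves the bound once [n] exceeds
    [s * 4 ^+ a * a]. Base 4 is chosen to beat the order 2^-n of the other factor. *)
Lemma short_coef_bound (a : nat) (s : R) : 0 <= s ->
  exists2 C, 0 <= C & forall n, cycle_coef (short_weight a s) n * 4 ^+ n <= C.
Proof.
move=> s0; set g := cycle_coef _; pose b n := g n * 4 ^+ n.
have b0 n : 0 <= b n.
  rewrite mulr_ge0 ?exprn_ge0 ?cycle_coef_ge0 // => l.
  exact: short_weight_ge0.
pose J := Num.bound (s * 4 ^+ a * a%:R).
have ltJ : s * 4 ^+ a * a%:R < J%:R.
  by apply: archi_boundP; rewrite !mulr_ge0 ?exprn_ge0.
pose C := \sum_(k < J.+1) b k.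
have C0 : 0 <= C by apply: sumr_ge0.
exists C => // n; rewrite -/(b n); elim/ltn_ind: n => n IHn.
have [lt_nJ|lt_Jn] := ltnP n J.+1.
  by rewrite /C (bigD1 (Ordinal lt_nJ)) //= lerDl sumr_ge0.
have n0 : 0 < n%:R :> R by rewrite ltr0n; apply: leq_trans lt_Jn.
rewrite -(ler_pM2l n0) /b mulrA /g cycle_coef_rec mulr_suml.
apply: (@le_trans _ _ (\sum_(k < n) if (n - k <= a)%N then s * 4 ^+ a * C else 0)).
  apply: ler_sum => -[k /= lt_kn] _; rewrite {1}/short_weight ltnNge.
  case: leqP => [le_a|_] /=; last by rewrite !mul0r.
  rewrite -{1}(subnK (ltnW lt_kn)) exprD.
  rewrite mulrA [_ * g k * _]mulrAC -[leLHS]mulrA -/(b k).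
  apply: ler_pM; rewrite ?b0 ?IHn ?mulr_ge0 ?exprn_ge0 //.
  by rewrite ler_wpM2l // ler_weXn2l // ler1n.
rewrite -big_mkcond sumr_const -[leLHS]mulr_natr.
have card_le : (#|[pred k : 'I_n | (n - k <= a)%N]| <= a)%N.
  have [le_an|lt_na] := leqP a n; last first.
    by apply: leq_trans (max_card _) _; rewrite card_ord ltnW.
  rewrite -sum1_card (reindex_inj rev_ord_inj) /=.
  rewrite (eq_bigl (fun k : 'I_n => (k < a)%N)) => [|k]; last first.
    by rewrite inE /=; move: (ltn_ord k) => /=; lia.
  by rewrite (big_ord_narrow le_an) sum1_card card_ord.
apply: (@le_trans _ _ (s * 4 ^+ a * a%:R * C)).
  rewrite mulrAC ler_wpM2r // ler_wpM2l ?mulr_ge0 ?exprn_ge0 // ler_nat.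
  exact: card_le.
by rewrite ler_wpM2r // (le_trans (ltW ltJ)) // ler_nat ltnW.
Qed.

Section ConstantWeight.
Variables (s : R) (t : nat).
Hypotheses (ts : t%:R < s) (st : s < t.+1%:R).
Let c := cycle_coef (fun=> - s).

(** The ratio of consecutive coefficients has the sign of [k - s]: negative up to [k = t], positive
    afterwards. So the signs alternate up to index [t + 1] and then stay. *)
Lemma const_coef_sign n : (t < n)%N -> 0 < (-1) ^+ t.+1 * c n.
Proof.
have c_rec k : c k.+1 = (k%:R - s) / k.+1%:R * c k.
  by apply: (@mulfI _ k.+1%:R); rewrite ?pnatr_eq0 // cycle_coef_const -/(c k); field; rewrite nat1r pnatr_eq0.
have c_small k : (k <= t.+1)%N -> 0 < (-1) ^+ k * c k.
  elim: k => [_|k IHk lt_kt]; first by rewrite expr0 mul1r /c cycle_coef0.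
  rewrite c_rec exprS (_ : _ * _ = (s - k%:R) / k.+1%:R * ((-1) ^+ k * c k));
    last by ring.
  rewrite mulr_gt0 ?IHk 1?ltnW // divr_gt0 ?ltr0n // subr_gt0.
  by apply: le_lt_trans ts; rewrite ler_nat.
elim: n => // n IHn; rewrite ltnS leq_eqVlt => /predU1P[<-|lt_tn].
  exact: c_small.
rewrite c_rec mulrCA mulr_gt0 ?IHn // divr_gt0 ?ltr0n // subr_gt0.
by apply: lt_le_trans st _; rewrite ler_nat.
Qed.

(** Consecutive scaled values have ratio 2 (n - s) / (n + 1), which is at least 1 for n >= 2 s + 1,
    hence for n >= 2 t + 3. *)
Lemma const_coef_lower_bound :
  exists2 C, 0 < C &
    forall n, (2 * t + 3 <= n)%N -> C <= (-1) ^+ t.+1 * c n * 2 ^+ n.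
Proof.
pose b n := (-1) ^+ t.+1 * c n * 2 ^+ n.
have b_gt0 n : (t < n)%N -> 0 < b n.
  by move=> /const_coef_sign c0; rewrite mulr_gt0 ?exprn_gt0.
exists (b (2 * t + 3)%N) => [|n]; first by apply: b_gt0; lia.
elim: n => [|n IHn]; first by rewrite leqn0 addn3.
rewrite leq_eqVlt => /predU1P[<-|/[1!ltnS] le_tn]; first exact: lexx.
apply: le_trans (IHn le_tn) _; rewrite -/(b n) -/(b n.+1).
have n1_gt0 : 0 < n.+1%:R :> R by rewrite ltr0n.
rewrite -(ler_pM2l n1_gt0).
have -> : n.+1%:R * b n.+1 = (2 * (n%:R - s)) * b n.
  rewrite /b [2 ^+ _]exprS (_ : _ * _ = (-1) ^+ t.+1 * (n.+1%:R * c n.+1) * (2 * 2 ^+ n));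
    last by ring.
  by rewrite cycle_coef_const -/(c n); ring.
rewrite ler_wpM2r ?ltW ?b_gt0 //; first by lia.
have : (2 * t + 3)%N%:R <= n%:R :> R by rewrite ler_nat.
rewrite natrD natrM -natr1; move: st; rewrite -natr1; lra.
Qed.

End ConstantWeight.

Lemma derangement_coef_sign (a t : nat) (s : R) :
    t%:R < s -> s < t.+1%:R ->
  exists N, forall n, (N <= n)%N ->
    0 < (-1) ^+ t.+1 * cycle_coef (derangement_weight a (- s)) n.
Proof.
move=> ts st; have s0 : 0 <= s by apply: le_trans (ltW ts).
have [C C0 gC] := short_coef_bound a s0.
have [C' C'0 cC'] := const_coef_lower_bound ts st.
set g := cycle_coef (short_weight a s) in gC.
set c := cycle_coef (fun=> - s) in cC'.
have g0 n : 0 <= g n by apply: cycle_coef_ge0 => l; apply: short_weight_ge0.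
(* [K] will bound the first [t + 1] terms of the convolution, scaled by 4^n. *)
pose K := \sum_(0 <= k < t.+1) `|c k| * (C * 4 ^+ k).
have K0 : 0 <= K.
  by apply: sumr_ge0 => k _; rewrite !mulr_ge0 ?exprn_ge0.
(* The second threshold gives [K / C' < 2 ^+ n]. *)
exists (maxn (2 * t + 3) (Num.bound (K / C'))) => n.
rewrite geq_max => /andP[le_tn le_Kn].
(* The derangement weight is the constant [- s] plus the short weight of [s]. *)
have -> : cycle_coef (derangement_weight a (- s)) n =
          \sum_(0 <= k < n.+1) c k * g (n - k)%N.
  rewrite big_mkord -cycle_coefD; apply: eq_cycle_coef => l.
  by rewrite /derangement_weight /short_weight; case: ifP; rewrite ?addr0 ?addNr.
rewrite (big_cat_nat _ (n := t.+1)) //=; last by lia.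
(* The term [k = n] is isolated: there [g 0 = 1], and it alone outweighs the initial terms. *)
rewrite [X in _ + X]big_nat_recr /=; last by lia.
rewrite subnn /g cycle_coef0 mulr1 -/g.
set S1 := \sum_(0 <= k < t.+1) _; set S2 := \sum_(t.+1 <= k < n) _.
have S1K : `|S1| * 4 ^+ n <= K.
  apply: (@le_trans _ _ ((\sum_(0 <= k < t.+1) `|c k * g (n - k)%N|) * 4 ^+ n)).
    by rewrite ler_wpM2r ?exprn_ge0 // ler_norm_sum.
  rewrite mulr_suml; apply: ler_sum_nat => k /andP[_ lt_kt].
  rewrite normrM (ger0_norm (g0 _)) -mulrA ler_wpM2l //.
  rewrite -{2}(@subnK k n); last by lia.
  by rewrite exprD mulrA ler_wpM2r ?exprn_ge0 // gC.
have S2_ge0 : 0 <= (-1) ^+ t.+1 * S2.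
  rewrite mulr_sumr big_nat; apply: sumr_ge0 => k /andP[lt_tk _].
  by rewrite mulrA mulr_ge0 // ltW // const_coef_sign.
have S1_ge : - `|S1| <= (-1) ^+ t.+1 * S1.
  by apply: lerNnormlW; rewrite normrM normrX normrN1 expr1n mul1r.
have := cC' n le_tn; set d := _ * c n => cn.
have Kn : K < C' * 2 ^+ n.
  by rewrite mulrC -ltr_pdivrMr //; apply: upper_nthrootP.
have S1d : `|S1| < d.
  rewrite -(@ltr_pM2r _ (4 ^+ n)) ?exprn_gt0 //.
  apply: le_lt_trans S1K (lt_le_trans Kn _).
  have -> : 4 ^+ n = 2 ^+ n * 2 ^+ n :> R by rewrite -exprMn; congr (_ ^+ _); ring.
  by rewrite mulrA ler_wpM2r ?exprn_ge0.
by rewrite !mulrDr -/d; lra.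
Qed.

End Asymptotics.

(** * The sign change at a negative integer *)

Theorem theorem3p6 (R : realType) (t a : nat) (eps : R)
    (ht : (0 < t)%N) (ha : (0 < a)%N) (heps : 0 < eps) :
  exists N : nat, (0 < N)%N /\
    forall n : nat, (N < n)%N ->
      exists x : R, root (derangement_poly R n a) x /\ `|- t%:R - x| < eps.
Proof.
(* From here [t.+1] is the given integer; [d < 1] keeps [t.+1 - d] and [t.+1 + d] in the open unit
   intervals on either side of it, where the signs are opposite. *)
case: t ht => // t _; pose d : R := Num.min eps 1 / 2.
have [d0 d1 de] : [/\ 0 < d, d < 1 & d < eps].
  by rewrite /d; case: (leP eps 1) => ?; split; lra.
have tS : t.+1%:R = t%:R + 1 :> R by rewrite natr1.
have tSS : t.+2%:R = t%:R + 2 :> R by rewrite -addn2 natrD.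
have [N1 sg1] : exists N, forall n, (N <= n)%N -> 0 < (-1) ^+ t.+1 *
    cycle_coef (derangement_weight a (- (t.+1%:R - d))) n.
  by apply: derangement_coef_sign; lra.
have [N2 sg2] : exists N, forall n, (N <= n)%N -> 0 < (-1) ^+ t.+2 *
    cycle_coef (derangement_weight a (- (t.+1%:R + d))) n.
  by apply: derangement_coef_sign; lra.
exists (N1 + N2).+1; split=> // n lt_n; have n0 : (0 < n)%N by lia.
have f0 : 0 < n`!%:R :> R by rewrite ltr0n fact_gt0.
(* The sign factor makes [p] nonpositive at the left endpoint and nonnegative at the right one, as
   [poly_ivt] requires. *)
pose p := (-1) ^+ t.+1 *: derangement_poly R n a.
have hp x : p.[x] =
    (-1) ^+ t.+1 * cycle_coef (derangement_weight a x) n * n`!%:R.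
  by rewrite hornerZ horner_derangement_poly // -mulrA divfK ?gt_eqF.
have p1 : 0 <= p.[- (t.+1%:R - d)].
  by rewrite hp mulr_ge0 ?ltW // sg1 //; lia.
have p2 : p.[- (t.+1%:R + d)] <= 0.
  rewrite hp mulr_le0_ge0 ?(ltW f0) // -oppr_ge0 -mulNr -mulN1r -exprS.
  by rewrite ltW // sg2 //; lia.
have [||x /andP[x1 x2] px] := @poly_ivt R p (- (t.+1%:R + d)) (- (t.+1%:R - d)).
- by lra.
- by rewrite p2.
exists x; split; first by move: px; rewrite rootZ ?signr_eq0.
by rewrite ltr_norml; lra.
Qed.
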